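(* Let $G$ be a cyclically 4-edge connected cubic graph containing a cycle of length 6. Then for every cycle $H$ of length 6 in $G$, either $G-V(H)$ has a perfect matching, or $G-V(H)$ is bipartite.
   Context: A graph $G$ is cyclically $k$-edge connected if deleting fewer than $k$ edges of $G$ cannot separate $G$ into two components each of which contains a cycle. $G-V(H)$ denotes the graph obtained from $G$ by deleting all vertices of $H$ together with their incident edges. *)

(* Defs.v *)
From HB Require Import structures.
From mathcomp Require Import all_boot.

Set Implicit Arguments.
Unset Strict Implicit.
Unset Printing Implicit Defensive.

Record sgraph := SGraph {
  vertex :> finType;
  adj : rel vertex;
  adj_sym : symmetric adj;
  adj_irrefl : irreflexive adj }.

Section SGraphTheory.
Variable G : sgraph.

Definition edges : {set {set G}} :=
  [set E | [exists x, exists y, adj x y && (E == [set x; y])]].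

Definition cubic : Prop := forall x : G, #|[set y | adj x y]| = 3.

(* Cycles are given by the cyclic sequence of their vertices; at least three
   vertices are required since [ucycle] accepts [:: x; y] for an edge xy. *)
Definition is_cycle (c : seq G) : Prop := ucycle (@adj G) c /\ 2 < size c.

Definition components : {set {set G}} :=
  [set [set y | connect (@adj G) x y] | x : G].

Definition contains_cycle (C : {set G}) : Prop :=
  exists2 c : seq G, is_cycle c & {subset c <= C}.

Definition bipartite : Prop :=
  exists A : {set G}, forall x y : G, adj x y -> (x \in A) != (y \in A).

Definition matching (M : {set {set G}}) : bool :=
  (M \subset edges) && trivIset M.

Definition has_perfect_matching : Prop :=
  exists2 M : {set {set G}}, matching M & cover M = [set: G].

Section DeleteEdges.
Variable F : {set {set G}}.
Definition del_edges_adj : rel G :=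
  [rel x y | adj x y && ([set x; y] \notin F)].
Fact del_edges_sym : symmetric del_edges_adj.
Proof. by move=> x y; rewrite /del_edges_adj /= adj_sym setUC. Qed.
Fact del_edges_irrefl : irreflexive del_edges_adj.
Proof. by move=> x; rewrite /del_edges_adj /= adj_irrefl. Qed.
Definition del_edges : sgraph := SGraph del_edges_sym del_edges_irrefl.
End DeleteEdges.

Section DeleteVertices.
Variable A : {set G}.
Definition del_vertices_adj : rel {x : G | x \notin A} :=
  [rel x y | adj (val x) (val y)].
Fact del_vertices_sym : symmetric del_vertices_adj.
Proof. by move=> x y; rewrite /del_vertices_adj /= adj_sym. Qed.
Fact del_vertices_irrefl : irreflexive del_vertices_adj.
Proof. by move=> x; rewrite /del_vertices_adj /= adj_irrefl. Qed.
Definition del_vertices : sgraph :=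
  SGraph del_vertices_sym del_vertices_irrefl.
End DeleteVertices.

End SGraphTheory.

(* Two distinct components of G - F containing cycles are excluded even when
   G - F has further components; F = set0 is allowed, so a cubic graph with
   this property for k > 0 is connected. *)
Definition cyclically_edge_connected (k : nat) (G : sgraph) : Prop :=
  forall F : {set {set G}}, F \subset edges G -> #|F| < k ->
  ~ exists C D : {set del_edges F},
      [/\ C \in components (del_edges F), D \in components (del_edges F),
          C != D, contains_cycle C & contains_cycle D].

(* Main.v *)
Require Import Defs.
From HB Require Import structures.
From mathcomp Require Import all_boot zify.

(* Apply the Tutte-Berge theorem to G - V(H).  If no matching is perfect, there
   are a set S and, by parity, at least |S| + 2 pairwise disjoint odd sets C of
   vertices whose edges leave C only towards S and V(H).  By cyclic
   4-edge-connectivity each of them is left by at least 3 edges, and by exactly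
   3 only if it is a singleton.  But S and V(H) can receive at most 3|S| + 6
   edges, so all these bounds are equalities: the sets are singletons, every
   edge of S goes to one of them, and no further vertices exist.  Hence S and
   its complement form a bipartition of G - V(H). *)

Set Implicit Arguments.
Unset Strict Implicit.
Unset Printing Implicit Defensive.

(** * Matchings as involutions and the Tutte-Berge theorem *)

Lemma fixfree_involution_even (T : finType) (f : T -> T) (B : {set T}) :
  involutive f -> {in B, forall x, f x \in B} -> {in B, forall x, f x != x} ->
  ~~ odd #|B|.
Proof.
move=> fK; have [n] := ubnP #|B|; elim: n B => // n IHn B ltBn fB fNx.
have [->|[x xB]] := set_0Vmem B; first by rewrite cards0.
have fxB : f x \in B :\ x by rewrite !inE fNx ?fB.
rewrite (cardsD1 x) xB (cardsD1 (f x) (B :\ x)) fxB /= negbK.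
apply: IHn => [|y|y].
- by move: ltBn; rewrite (cardsD1 x) xB (cardsD1 (f x) (B :\ x)) fxB => /ltnW.
- rewrite !inE => /and3P[yNfx yNx yB].
  by rewrite (can_eq fK) yNx fB // andbT -(can_eq fK) fK eq_sym eq_sym.
- by rewrite !inE => /and3P[_ _ /fNx].
Qed.

Section TutteBerge.
Variables (T : finType) (e : rel T).
Hypotheses (e_sym : symmetric e) (e_irr : irreflexive e).
Implicit Types (A S C : {set T}) (P : {set {set T}}) (m n : {ffun T -> T}).

(* A matching is encoded as the involution exchanging the ends of its edges;
   the vertices that it misses are the fixed points. *)
Definition matching_on A m :=
  [forall x, (m (m x) == x) && ((m x != x) ==> (x \in A) && e x (m x))].

Definition exposed A m := [set x in A | m x == x].

Definition max_matching A m :=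
  matching_on A m &&
  [forall n, matching_on A n ==> (#|exposed A m| <= #|exposed A n|)].

Definition never_both_exposed A u v :=
  [forall m, max_matching A m ==>
     ~~ ((u \in exposed A m) && (v \in exposed A m))].

(** The closure condition makes each member of [P] a union of components of the graph on [A :\: S],
    possibly of several at once. *)
Definition odd_barrier A S P :=
  [/\ S \subset A, trivIset P & forall C, C \in P ->
    [/\ C \subset A :\: S, odd #|C| &
        forall x y, x \in C -> y \in A :\: S -> e x y -> y \in C]].

(** Meant for a vertex [x] missed by [m]: the edge xy enters the matching, and the former partner
    [m y] of [y], if any, is released. *)
Definition rematch m x y : {ffun T -> T} :=
  [ffun w => if w == x then y else if w == y then x
             else if w == m y then w else m w].

Lemma matching_onP A m :
  reflect (involutive m /\ forall x, m x != x -> x \in A /\ e x (m x))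
          (matching_on A m).
Proof.
apply: (iffP forallP) => [mP|[mK mP] x].
  split=> x; first by have /andP[/eqP] := mP x.
  by have /andP[_ /implyP mx] := mP x; move=> /mx/andP.
by rewrite mK eqxx; apply/implyP => /mP[-> ->].
Qed.

Arguments matching_onP {A m}.

Lemma odd_exposed A m : matching_on A m -> odd #|exposed A m| = odd #|A|.
Proof.
move=> /matching_onP[mK mP].
rewrite -(cardsID (exposed A m) A) oddD.
have -> : A :&: exposed A m = exposed A m.
  by apply/setP=> x; rewrite !inE andbA andbb.
suff /negPf-> : ~~ odd #|A :\: exposed A m| by rewrite addbF.
apply: (fixfree_involution_even mK) => x /setDP[xA]; rewrite !inE xA //= => mx.
by rewrite mK eq_sym (negPf mx) andbF (mP (m x) _).1 // mK eq_sym.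
Qed.

Lemma rematch_matching A m x y :
  matching_on A m -> m x = x -> x \in A -> y \in A -> e x y ->
  matching_on A (rematch m x y).
Proof.
move=> /matching_onP[mK mP] mx xA yA exy.
have xNy : x != y by apply: contraTneq exy => ->; rewrite e_irr.
apply/matching_onP; split=> w; rewrite !ffunE.
  have [->|wNx] := eqVneq w x; first by rewrite eqxx eq_sym (negPf xNy).
  have [->|wNy] := eqVneq w y; first by rewrite eqxx.
  have [wmy|wNmy] := eqVneq w (m y).
    by rewrite (negPf wNx) (negPf wNy) wmy eqxx.
  rewrite -{1}mx (can_eq mK) (negPf wNx).
  by rewrite (can2_eq mK mK) (negPf wNmy) (can_eq mK) (negPf wNy) mK.
have [->|wNx] := eqVneq w x; first by rewrite xA exy.
have [->|wNy] := eqVneq w y; first by rewrite yA e_sym exy.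
by have [->|_] := eqVneq w (m y); [rewrite eqxx | apply: mP].
Qed.

Lemma exposed_rematch A m x y : x != y ->
  exposed A (rematch m x y) =
  [set w in A | [&& w != x, w != y & (w == m y) || (m w == w)]].
Proof.
move=> xNy; apply/setP=> w; rewrite !inE ffunE.
have [->|_] := eqVneq w x; first by rewrite eq_sym (negPf xNy).
have [->|_] := eqVneq w y; first by rewrite (negPf xNy).
by have [->|_] := eqVneq w (m y); rewrite ?eqxx.
Qed.

Lemma max_matching_exists A : exists m, max_matching A m.
Proof.
have m0 : matching_on A (finfun id).
  by apply/matching_onP; split=> x; rewrite !ffunE // eqxx.
have [m mP mmin] := arg_minnP (fun m => #|exposed A m|) m0.
by exists m; rewrite /max_matching mP; apply/forallP => n; apply/implyP/mmin.
Qed.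

Lemma max_matching_le A m n :
  max_matching A m -> matching_on A n -> #|exposed A m| <= #|exposed A n|.
Proof. by case/andP=> _ /forallP/(_ n)/implyP. Qed.

(** Otherwise adding the edge xy would give a matching that misses fewer vertices. *)
Lemma adj_never_both_exposed A x y :
  x \in A -> y \in A -> e x y -> never_both_exposed A x y.
Proof.
move=> xA yA exy; apply/forallP => m; apply/implyP => maxm.
apply/negP => /andP[xm ym].
have xNy : x != y by apply: contraTneq exy => ->; rewrite e_irr.
have [mA _] := andP maxm.
have [/eqP mx /eqP my] : m x == x /\ m y == y.
  by move: xm ym; rewrite !inE => /andP[_ ?] /andP[].
have := max_matching_le maxm (rematch_matching mA mx xA yA exy).
apply/negP; rewrite -ltnNge exposed_rematch //.
apply/proper_card/properP; split.
  apply/subsetP => w; rewrite !inE my.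
  by case/andP=> -> /and3P[_ /negPf->].
by exists x => //; rewrite !inE eqxx /= !andbF.
Qed.

(* Gallai's exchange argument: were u and v both missed by a maximum matching
   m, take a maximum matching n missing t that agrees with m as much as
   possible; some x != t is missed by n but not by m, and rematching x in n
   along its m-edge increases the agreement. *)
Lemma never_both_exposed_trans A u t v :
  (exists2 n, max_matching A n & t \in exposed A n) ->
  u != v -> never_both_exposed A u t -> never_both_exposed A t v ->
  never_both_exposed A u v.
Proof.
case=> n0 maxn0 tn0 uNv ut tv; apply/forallP => m; apply/implyP => maxm.
apply/negP => /andP[um vm].
pose missing_t n := max_matching A n && (t \in exposed A n).
have n0P : missing_t n0 by rewrite /missing_t maxn0.
have [n /andP[maxn tn] nmax] :=
  arg_maxnP (fun n : {ffun T -> T} => #|[set w | m w == n w]|) n0P.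
have [mA _] := andP maxm; have [nA _] := andP maxn.
have [mK mP] := elimT matching_onP mA; have [nK nP] := elimT matching_onP nA.
have un : u \notin exposed A n.
  by have /forallP/(_ n)/implyP/(_ maxn) := ut; rewrite tn andbT.
have vn : v \notin exposed A n.
  by have /forallP/(_ n)/implyP/(_ maxn) := tv; rewrite tn.
have tm : t \notin exposed A m.
  by have /forallP/(_ m)/implyP/(_ maxm) := ut; rewrite um.
have eq_mn : #|exposed A m| = #|exposed A n|.
  by apply/eqP; rewrite eqn_leq !max_matching_le.
(* Both matchings miss equally many vertices, and [u] and [v] are missed by [m] only. So [n] misses
   at least two vertices that [m] covers, one of them other than [t]. *)
have : 1 < #|exposed A n :\: exposed A m|.
  rewrite -(leq_add2l #|exposed A n :&: exposed A m|) cardsID -eq_mn.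
  rewrite -(cardsID (exposed A n) (exposed A m)) setIC leq_add2l.
  have <- : #|[set u; v]| = 2 by rewrite cards2 uNv.
  by apply/subset_leq_card/subsetP=> w; rewrite inE => /orP[]/set1P->;
    rewrite inE ?um ?vm ?un ?vn.
rewrite (cardsD1 t) inE tm tn ltnS card_gt0 => /set0Pn[x].
rewrite !inE => /and3P[xNt + /andP[xA /eqP nx]]; rewrite xA /= => mx.
have [_ exy] := mP x mx; set y := m x in mx exy.
have my : m y = x by rewrite mK.
have yA : y \in A by apply: (mP y _).1; rewrite my eq_sym.
have xn : x \in exposed A n by rewrite inE xA nx /=.
have ny : n y != y.
  have /forallP/(_ n)/implyP/(_ maxn) := adj_never_both_exposed xA yA exy.
  by rewrite xn inE yA.
have n'A := rematch_matching nA nx xA yA exy.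
have nyNx : n y != x by rewrite -{1}nx (can_eq nK).
have nyA : n y \in A by apply: (nP (n y) _).1; rewrite nK eq_sym.
(* Rematching trades the missed vertex [x] for [n y], so the new matching is still maximum and still
   misses [t]. *)
have En' : exposed A (rematch n x y) = n y |: (exposed A n :\ x).
  rewrite exposed_rematch 1?eq_sym //; apply/setP => w; rewrite !inE.
  have [->|wNny] := eqVneq w (n y); first by rewrite nyA nyNx ny.
  rewrite /= andbCA; congr (_ && _); have [->|] //= := eqVneq w y.
  by rewrite (negPf ny) andbF.
have cn' : #|exposed A (rematch n x y)| = #|exposed A n|.
  rewrite En' cardsU1 !inE nK (eq_sym y) (negPf ny) !andbF.
  by rewrite [in RHS](cardsD1 x) xn.
have maxn' : max_matching A (rematch n x y).
  rewrite /max_matching n'A; apply/forallP => k; apply/implyP => kA.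
  by rewrite cn' max_matching_le.
have tn' : t \in exposed A (rematch n x y).
  by rewrite En' in_setU1 in_setD1 tn andbT [t == x]eq_sym xNt orbT.
have := nmax (rematch n x y); rewrite /missing_t maxn' tn' => /(_ isT).
(* Agreement is gained at [x]. None is lost at [n y]: if [m] and [n] agreed there, [n y] would be
   [m y], that is [x]. *)
apply/negP; rewrite -ltnNge; apply/proper_card/properP; split.
  apply/subsetP => w; rewrite !inE ffunE => /eqP mn.
  have [wx|_] := eqVneq w x; first by rewrite wx.
  have [wy|_] := eqVneq w y; first by rewrite wy my.
  have [wz|_] := eqVneq w (n y); last by rewrite mn.
  by move: mn nyNx; rewrite wz nK => /(congr1 m); rewrite mK my => ->; rewrite eqxx.
by exists x; rewrite !inE ?ffunE ?eqxx // nx.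
Qed.

(* If some v is missed by no maximum matching, delete it and put it into S.
   Otherwise "never both missed" is an equivalence relation containing
   adjacency, and with S empty the classes of the missed vertices form the
   barrier. *)
Lemma tutte_berge A : exists m S P,
  [/\ matching_on A m, odd_barrier A S P & #|exposed A m| + #|S| <= #|P|].
Proof.
have [k] := ubnP #|A|; elim: k A => // k IHk A ltAk.
have [m maxm] := max_matching_exists A; have [mA _] := andP maxm.
have [mK mP] := elimT matching_onP mA.
have [/forallP allexp|] := boolP [forall v, (v \in A) ==>
    [exists n, max_matching A n && (v \in exposed A n)]]; last first.
  rewrite negb_forall => /existsP[v]; rewrite negb_imply negb_exists.
  case/andP=> vA /forallP covv.
  have [|m' [S [P [m'A [sS tP PP] le]]]] := IHk (A :\ v).
    by move: ltAk; rewrite (cardsD1 v) vA.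
  have [m'K m'P] := elimT matching_onP m'A.
  have m'v : m' v = v.
    by apply/eqP/negP => /negP/m'P[]; rewrite !inE eqxx.
  have m'A' : matching_on A m'.
    by apply/matching_onP; split=> // x /m'P[] /setD1P[].
  have AvS : A :\: (v |: S) = (A :\ v) :\: S by rewrite setDDl.
  exists m, (v |: S), P; split=> //.
    split=> // [|C /PP]; last by rewrite AvS.
    by rewrite subUset sub1set vA (subset_trans sS) ?subsetDl.
  have vS : v \notin S by apply/negP => /(subsetP sS); rewrite !inE eqxx.
  rewrite cardsU1 vS add1n addnS -addSn; apply: leq_trans le.
  rewrite leq_add2r.
  have E : exposed A m' = v |: exposed (A :\ v) m'.
    apply/setP => w; rewrite !inE; have [->|] //= := eqVneq w v.
    by rewrite vA m'v eqxx.
  have cE : #|exposed A m'| = #|exposed (A :\ v) m'|.+1.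
    by rewrite E cardsU1 !inE eqxx.
  (* As a matching of [A], [m'] misses [v] and hence is not maximum. This excess over [m] is at
     least 2 by parity: one pays for [v] being missed by [m'], the other for [v] entering [S]. *)
  have lt : #|exposed A m| < #|exposed A m'|.
    rewrite ltnNge; apply/negP => ge; have := covv m'; rewrite negb_and.
    rewrite !inE vA m'v eqxx orbF => /negP[]; rewrite /max_matching m'A'.
    apply/forallP => n; apply/implyP => nA.
    exact: leq_trans ge (max_matching_le maxm nA).
  rewrite cE ltnS leq_eqVlt in lt; case/orP: lt => // /eqP eq.
  have := odd_exposed m'A'; rewrite -(odd_exposed mA) cE eq /=.
  by case: odd.
have {}allexp v : v \in A -> exists2 n, max_matching A n & v \in exposed A n.
  by move=> vA; have /implyP/(_ vA)/existsP[n /andP[]] := allexp v; exists n.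
pose R u v := (u == v) || never_both_exposed A u v.
have Rsym u v : R u v -> R v u.
  rewrite /R eq_sym; case: eqP => //= _ /forallP uv; apply/forallP => n.
  by rewrite andbC.
have Rtrans u v w : v \in A -> R u v -> R v w -> R u w.
  rewrite /R; have [->|uNv] //= := eqVneq u v.
  have [->|vNw] //= := eqVneq v w; first by move=> _ ->; rewrite orbT.
  have [->|uNw] //= := eqVneq u w.
  by move=> /allexp/never_both_exposed_trans; apply.
have Radj x y : x \in A -> y \in A -> e x y -> R x y.
  by move=> xA yA exy; rewrite /R adj_never_both_exposed ?orbT.
pose cls u := [set v in A | R u v].
have clsE u v : u \in A -> v \in A -> R u v -> cls u = cls v.
  move=> uA vA uv; apply/setP => w; rewrite !inE; case: (w \in A) => //=.
  by apply/idP/idP; apply: Rtrans => //; apply: Rsym.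
have cls_inj : {in exposed A m &, injective cls}.
  move=> u v um vm uv; apply/eqP; apply: contraT => uNv.
  have [uA vA] : u \in A /\ v \in A.
    by move: um vm; rewrite !inE => /andP[-> _] /andP[-> _].
  have : v \in cls u by rewrite uv inE vA /R eqxx.
  rewrite inE vA /R (negPf uNv) /= => /forallP/(_ m).
  by rewrite maxm um vm.
exists m, set0, (cls @: exposed A m); split=> //; last first.
  by rewrite cards0 addn0 card_in_imset.
split; first exact: sub0set.
  apply/trivIsetP => _ _ /imsetP[u um ->] /imsetP[v vm ->].
  apply: contraR => /pred0Pn[w] /=; rewrite !inE => /andP[/andP[wA uw] /andP[_ vw]].
  have [uA vA] : u \in A /\ v \in A.
    by move: um vm; rewrite !inE => /andP[-> _] /andP[-> _].
  by rewrite (clsE _ w) // (clsE v w).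
move=> _ /imsetP[u um ->]; have /setIdP[uA /eqP mu] := um.
rewrite setD0; split.
- by apply/subsetP => w /setIdP[].
(* The class is odd because [m] pairs its members other than [u]: matched vertices are adjacent,
   hence equivalent, and no second missed vertex lies in the class. *)
- have uC : u \in cls u by rewrite inE uA /R eqxx.
  rewrite (cardsD1 u) uC /=.
  apply: (fixfree_involution_even mK) => w; rewrite !inE => /and3P[wNu wA uw].
    have [->|mw] := eqVneq (m w) w; first by rewrite wNu wA.
    have [_ ew] := mP _ mw.
    have mwA : m w \in A by apply: (mP _ _).1; rewrite mK eq_sym.
    rewrite -{1}mu (can_eq mK) wNu mwA; apply: (Rtrans _ _ _ wA uw).
    exact: Radj.
  apply: contraNneq wNu => mw; have wm : w \in exposed A m by rewrite inE wA mw /=.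
  by apply/eqP/cls_inj => //; apply: clsE => //; apply: Rsym.
- move=> x y; rewrite !inE => /andP[xA ux] yA exy; rewrite yA.
  by apply: (Rtrans _ _ _ xA ux); apply: Radj.
Qed.

End TutteBerge.

(** * Degrees, edge counts, cycles and edge cuts *)

Lemma sum_squeeze (I : finType) (P : {set I}) (E F : I -> nat) :
  (forall i, i \in P -> E i <= F i) ->
  \sum_(i in P) F i <= \sum_(i in P) E i -> forall i, i \in P -> E i = F i.
Proof.
move=> leEF ge i Pi; have [_] := leqif_sum (fun i Pi => leqif_eq (leEF i Pi)).
rewrite eqn_leq ge leq_sum // => /esym/forallP/(_ i).
by rewrite Pi => /eqP.
Qed.

Section Degrees.
Variable G : sgraph.
Implicit Types (x y v : G) (C X Y : {set G}).

Definition deg x Y := \sum_(y in Y) @adj G x y.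

(* Number of pairs (x, y) with x in X, y in Y and x adjacent to y: an edge
   inside the intersection of X and Y counts twice. *)
Definition darts X Y := \sum_(x in X) deg x Y.

Lemma deg_card x Y : deg x Y = #|[set y in Y | adj x y]|.
Proof.
rewrite -sum1dep_card big_mkcondr /=.
by apply: eq_bigr => y _; case: adj.
Qed.

Lemma leq_deg x X Y :
  (forall y, y \in X -> adj x y -> y \in Y) -> deg x X <= deg x Y.
Proof.
move=> XY; rewrite !deg_card; apply/subset_leq_card/subsetP => y.
by rewrite !inE => /andP[yX xy]; rewrite xy XY.
Qed.

Lemma deg_setU x X Y : [disjoint X & Y] -> deg x (X :|: Y) = deg x X + deg x Y.
Proof. by move=> dXY; rewrite /deg -bigU //=; apply: eq_bigl => y; rewrite inE. Qed.

Lemma degC x C : deg x C + deg x (~: C) = deg x setT.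
Proof. by rewrite -deg_setU ?setUCr // -setI_eq0 setICr. Qed.

Lemma dartsC X Y : darts X Y = darts Y X.
Proof.
rewrite /darts /deg exchange_big; apply: eq_bigr => y _; apply: eq_bigr => x _.
by rewrite adj_sym.
Qed.

Lemma darts_setU X Y C :
  [disjoint X & Y] -> darts (X :|: Y) C = darts X C + darts Y C.
Proof.
by move=> dXY; rewrite /darts -bigU //=; apply: eq_bigl => y; rewrite inE.
Qed.

Lemma darts_setD1 C v :
  v \in C -> darts C C = darts (C :\ v) (C :\ v) + (deg v C).*2.
Proof.
move=> vC; have degD1 x : deg x C = adj x v + deg x (C :\ v).
  by rewrite /deg (big_setD1 v).
rewrite {1}/darts (big_setD1 v) //= addnC -addnn addnA; congr (_ + _).
rewrite (eq_bigr _ (fun x _ => degD1 x)) big_split /= addnC; congr (_ + _).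
rewrite degD1 adj_irrefl add0n; apply: eq_bigr => x _.
by rewrite adj_sym.
Qed.

Lemma odd_darts C : odd (darts C C) = false.
Proof.
have [n] := ubnP #|C|; elim: n C => // n IHn C ltC.
have [->|[v vC]] := set_0Vmem C; first by rewrite /darts big_set0.
rewrite (darts_setD1 vC) oddD odd_double addbF IHn //.
by move: ltC; rewrite (cardsD1 v) vC.
Qed.

(** A path in [C] is extended at its first vertex for as long as possible. Once stuck, that vertex
    has a neighbour on the path beyond its successor, which closes a cycle. *)
Lemma min_degree2_cycle C :
  C != set0 -> (forall x, x \in C -> 1 < deg x C) -> contains_cycle C.
Proof.
move=> /set0Pn[x0 x0C] degC2.
have walk k : contains_cycle C \/ exists x s,
    [/\ size s = k, path (@adj G) x s, uniq (x :: s) & {subset x :: s <= C}].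
  elim: k => [|k [cyc|[x [s [sk ps us sC]]]]]; last 2 first.
  - by left.
  - have xC : x \in C by rewrite sC ?mem_head.
    have [/existsP[y /and3P[yC xy yNs]]|] :=
      boolP [exists y, [&& y \in C, adj x y & y \notin x :: s]].
      right; exists y, (x :: s); split=> //=; first by rewrite sk.
      + by rewrite adj_sym xy.
      + by rewrite yNs.
      + by move=> z; rewrite inE => /orP[/eqP->|/sC].
    rewrite negb_exists => /forallP nbr; left.
    have := degC2 x xC.
    (* [head x s] is the successor of [x] on the path. For the one-vertex path it defaults to [x],
       which is no neighbour of itself. *)
    rewrite deg_card (cardsD1 (head x s)) -ltnS => dx.
    have : 0 < #|[set y in C | adj x y] :\ head x s|.
      by move: dx; case: (_ \in _); lia.
    rewrite card_gt0 => /set0Pn[y]; rewrite !inE => /and3P[yNh yC xy].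
    have : y \in x :: s by have := nbr y; rewrite yC xy negbK.
    rewrite inE; case/orP => [/eqP yx|ys]; first by rewrite yx adj_irrefl in xy.
    case/splitPr: ys yNh ps us sC {sk dx nbr} => -[|z s1] s2 /=.
      by rewrite eqxx.
    move=> _ /andP[xz]; rewrite cat_path /= => /and3P[ps1 s1y _] us sC.
    exists [:: x, z & rcons s1 y]; last first.
      move=> w w_in; apply: sC; move: w_in; rewrite !inE mem_cat mem_rcons !inE.
      by case/or3P => [->|->|/orP[->|->]]; rewrite ?orbT.
    split; last by rewrite /= size_rcons.
    apply/andP; split; first by rewrite /= xz !rcons_path last_rcons ps1 s1y adj_sym.
    have {us}: uniq ([:: x, z & s1] ++ y :: s2) by [].
    by rewrite -cat_rcons cat_uniq => /andP[].
  by right; exists x0, [::]; split=> // z; rewrite inE => /eqP->.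
(* A path with [#|C|] edges would have one vertex more than [C]. *)
have [//|[x [s [sk _ us sC]]]] := walk #|C|.
have : size (x :: s) <= size (enum C).
  by apply: uniq_leq_size us _ => z /sC; rewrite mem_enum.
by rewrite -cardE /= sk ltnn.
Qed.

(** Removing a vertex with at most one neighbour in [C] costs at most two darts, so the bound
    persists. When no such vertex is left, all inner degrees are at least 2. *)
Lemma dense_cycle C :
  C != set0 -> #|C|.*2 <= darts C C -> contains_cycle C.
Proof.
have [n] := ubnP #|C|; elim: n C => // n IHn C ltC C0 dC.
have [/forallP min2|] := boolP [forall x, (x \in C) ==> (1 < deg x C)].
  by apply: min_degree2_cycle => // x xC; apply: implyP (min2 x) xC.
rewrite negb_forall => /existsP[v]; rewrite negb_imply -leqNgt => /andP[vC dv].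
have cC : #|C| = #|C :\ v|.+1 by rewrite (cardsD1 v) vC.
rewrite (darts_setD1 vC) cC in dC.
have [|||c cyc sc] := IHn (C :\ v).
- by rewrite -ltnS -cC.
- apply: contraTneq dC => E; rewrite E cards0 /darts big_set0 -ltnNge.
  have -> : deg v C = 0; last by [].
  rewrite /deg (big_setD1 v) //= E big_set0 adj_irrefl.
  by [].
- by move: dC; rewrite doubleS; lia.
by exists c => // x /sc /setD1P[].
Qed.

Lemma component_cycle (F : {set {set G}}) X :
  {in X &, forall x y, [set x; y] \notin F} -> contains_cycle X ->
  exists2 x, x \in X &
    @contains_cycle (del_edges F) [set y | connect (@adj (del_edges F)) x y].
Proof.
move=> XF [[|x s] [/andP[cyc us] s2] sX] //.
have cycF : cycle (@adj (del_edges F)) (x :: s).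
  apply: (sub_in_cycle (P := mem X)) cyc; last by apply/allP.
  by move=> y z yX zX yz; apply/andP; split=> //; apply: XF.
exists x; first by rewrite sX ?mem_head.
exists (x :: s); first by split=> //; rewrite /ucycle cycF.
move=> y ys; rewrite inE; apply: (path_connect cycF).
by rewrite inE mem_rcons ys orbT.
Qed.

(** Delete the edges between [C] and its complement, at most one per dart. Both cycles survive, and
    since no component crosses the cut they lie in different components. *)
Lemma cyclic_cut k C :
  cyclically_edge_connected k G -> contains_cycle C -> contains_cycle (~: C) ->
  k <= darts C (~: C).
Proof.
move=> Gk cycC cycC'; rewrite leqNgt; apply/negP => lt.
pose D := [set p : G * G | [&& p.1 \in C, p.2 \in ~: C & adj p.1 p.2]].
pose F := [set [set p.1; p.2] | p in D].
have FP x y : [set x; y] \in F -> (x \in C) != (y \in C).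
  case/imsetP=> -[a b]; rewrite !inE /= => /and3P[aC bC _] E.
  have := set21 a b; have := set22 a b.
  rewrite -E !inE => /orP[]/eqP bE /orP[]/eqP aE; subst; rewrite ?aC ?(negPf bC) //.
    by rewrite aC in bC.
  by rewrite aC in bC.
have FE : F \subset edges G.
  apply/subsetP => _ /imsetP[[a b] + ->]; rewrite !inE /= => /and3P[_ _ ab].
  by apply/existsP; exists a; apply/existsP; exists b; rewrite ab eqxx.
have Fk : #|F| < k.
  apply: leq_ltn_trans lt; apply: (leq_trans (leq_imset_card _ _)).
  rewrite -sum1dep_card /darts /deg pair_big_dep /=.
  rewrite big_mkcond [leqRHS]big_mkcond /=.
  apply: leq_sum => p _; case: (_ \in C); case: (_ \in ~: C) => //=; case: adj.
apply: (Gk F FE Fk).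
have [|x xC cx] := @component_cycle F C _ cycC.
  by move=> x y xC yC; apply/negP => /FP; rewrite xC yC.
have [|y yC cy] := @component_cycle F (~: C) _ cycC'.
  move=> a b; rewrite !inE => aC bC; apply/negP => /FP.
  by rewrite (negPf aC) (negPf bC).
have clC : closed (@adj (del_edges F)) (mem C).
  apply: intro_closed; first exact/sym_connect_sym/adj_sym.
  move=> a b /andP[ab abF] aC; apply: contraNT abF => bC.
  by apply/imsetP; exists (a, b); rewrite ?inE //= aC bC.
eexists; eexists; split; [exact: imset_f | exact: imset_f | | exact: cx | exact: cy].
apply/eqP => /setP/(_ y); rewrite !inE connect0 => /(closed_connect clC) /=.
by move: yC; rewrite inE xC => /negPf->.
Qed.

Lemma del_vertices_perfect_matching X (m : {ffun G -> G}) :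
  matching_on (@adj G) (~: X) m -> exposed (~: X) m = set0 ->
  has_perfect_matching (del_vertices X).
Proof.
move=> /matching_onP[mK mP] m0.
have mX x : x \notin X -> m x \notin X /\ adj x (m x).
  move=> xX; have mx : m x != x.
    by apply/negP => mx; have := in_set0 x; rewrite -m0 !inE xX mx.
  have [_ ->] := mP x mx; split=> //.
  by have [] := mP (m x); rewrite ?inE // mK eq_sym.
pose mV (x : del_vertices X) : del_vertices X :=
  exist _ (m (val x)) (mX _ (valP x)).1.
have mVK : involutive mV by move=> x; apply: val_inj; rewrite /= mK.
exists [set [set x; mV x] | x : del_vertices X].
  apply/andP; split.
    apply/subsetP => _ /imsetP[x _ ->]; rewrite inE.
    apply/existsP; exists x; apply/existsP; exists (mV x); rewrite eqxx andbT.
    exact: (mX _ (valP x)).2.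
  apply/trivIsetP => _ _ /imsetP[x _ ->] /imsetP[y _ ->].
  apply: contraR => /pred0Pn[z] /=; rewrite !inE => /andP[zx zy].
  have E w : (z == w) || (z == mV w) -> [set w; mV w] = [set z; mV z].
    by case/orP=> /eqP-> //; rewrite mVK setUC.
  by rewrite (E x) // (E y).
apply/setP => x; rewrite inE; apply/bigcupP.
by exists [set x; mV x]; [apply: imset_f | apply: set21].
Qed.

End Degrees.

(** * Cubic graphs and the complement of the hexagon *)

Section Cubic.
Variable G : sgraph.
Hypothesis Gcubic : cubic G.
Implicit Types (x y : G) (C X Y : {set G}).

Lemma deg_setT x : deg x setT = 3.
Proof.
by rewrite deg_card -[RHS](Gcubic x); apply: eq_card => y; rewrite !inE.
Qed.

Lemma leq_deg3 x Y : deg x Y <= 3.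
Proof. by rewrite -(deg_setT x) -(degC x Y) leq_addr. Qed.

Lemma deg3_neighbours x Y y : 3 <= deg x Y -> adj x y -> y \in Y.
Proof.
move=> d3 xy; apply: contraTT d3 => yY; rewrite -ltnNge -(deg_setT x) -(degC x Y).
rewrite -addn1 leq_add2l deg_card card_gt0; apply/set0Pn; exists y.
by rewrite !inE yY.
Qed.

Lemma darts_cut C : darts C C + darts C (~: C) = 3 * #|C|.
Proof.
rewrite /darts -big_split /= mulnC -sum_nat_const.
by apply: eq_bigr => x _; rewrite degC deg_setT.
Qed.

Lemma cubic_even : ~~ odd #|G|.
Proof.
have := odd_darts [set: G].
have := darts_cut [set: G]; rewrite setCT.
have -> : darts [set: G] set0 = 0 by rewrite dartsC /darts big_set0.
by rewrite addn0 cardsT => ->; rewrite oddM /= => ->.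
Qed.

(* An odd set of at least three vertices leaving at most three edges is dense
   enough to contain a cycle, contradicting cyclic 4-edge-connectivity. *)
Lemma odd_cut C :
  cyclically_edge_connected 4 G -> contains_cycle (~: C) -> odd #|C| ->
  3 <= darts C (~: C) ?= iff (#|C| == 1).
Proof.
move=> G4 cycC oddC; have cut := darts_cut C.
have [/cards1P[x Cx]|C1] := boolP (#|C| == 1).
  split; move: cut; rewrite Cx cards1 {1}/darts big_set1 /deg big_set1;
    by rewrite adj_irrefl add0n => ->.
suff : 4 <= darts C (~: C).
  by move=> d4; split; [apply: leq_trans d4 | rewrite ltn_eqF].
rewrite leqNgt; apply/negP => lt4.
have C3 : 2 < #|C| by move: oddC C1; case: #|C| => [|[|[]]].
have := cyclic_cut G4 _ cycC; rewrite leqNgt lt4 => /(_ _)/notF; apply.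
(* At most three darts leave [C], so at least 3|C| - 3 stay inside, and this is at least 2|C|
   because |C| >= 3. *)
apply: dense_cycle; first by rewrite -card_gt0 (leq_trans _ C3).
lia.
Qed.


(** The hexagon enters as a set of six vertices that contains a cycle and keeps at least two of the
    three edges at each vertex, so that at most six edges leave it. *)
Lemma hexagon_complement (X : {set G}) :
  cyclically_edge_connected 4 G -> contains_cycle X -> #|X| = 6 ->
  (forall x, x \in X -> 1 < deg x X) ->
  has_perfect_matching (del_vertices X) \/ bipartite (del_vertices X).
Proof.
move=> G4 cycX X6 degX.
have [m [S [P [mX [sS tP PP] le]]]] :=
  tutte_berge (@adj_sym G) (@adj_irrefl G) (~: X).
have [m0|m0] := eqVneq (exposed (~: X) m) set0.
  by left; apply: del_vertices_perfect_matching m0.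
right.
(* The complement of [X] has an even number of vertices, so the nonzero number of missed ones is
   even too. *)
have exposed2 : 2 <= #|exposed (~: X) m|.
  have := odd_exposed mX; have := cubic_even; rewrite -(cardsC X) X6 oddD /=.
  by move: m0; rewrite -card_gt0; case: #|exposed _ _| => [|[|]] //= _ /negPf->.
set U := cover P.
have PU C x : C \in P -> x \in C -> x \in U.
  by move=> CP xC; apply/bigcupP; exists C.
have UX x : x \in U -> x \notin X /\ x \notin S.
  case/bigcupP=> C /PP[/subsetP sC _ _] /sC.
  by rewrite !inE => /andP[].
have PC C : C \in P -> 3 <= darts C (~: C) ?= iff (#|C| == 1).
  move=> /PP[/subsetP sC oddC _]; apply: odd_cut => //.
  have [c cyc sc] := cycX; exists c => // x /sc xX; rewrite inE.
  by apply/negP => /sC; rewrite !inE xX andbF.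
have SX_disj : [disjoint S & X].
  by rewrite disjoints_subset.
have degXU x : x \in X -> deg x U <= 1.
  move=> xX; have : deg x U + deg x X <= 3.
    rewrite -deg_setU ?leq_deg3 // disjoint_subset.
    by apply/subsetP => y /UX[].
  by have := degX x xX; lia.
(* An edge leaving a member of [P] cannot end elsewhere in [~: X :\: S], so it ends in [S] or
   [X]. *)
have upper : \sum_(C in P) darts C (~: C) <= darts S U + darts X U.
  rewrite -darts_setU // dartsC [leqRHS]/darts big_trivIset //=.
  apply: leq_sum => C CP; apply: leq_sum => x xC; apply: leq_deg => y.
  rewrite !inE => yC xy; have [_ _ clC] := PP C CP.
  by apply: contraNT yC => yN; apply: clC xC _ xy; rewrite !inE -negb_or.
have lower : 3 * #|P| <= \sum_(C in P) darts C (~: C).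
  by rewrite mulnC -sum_nat_const leq_sum // => C /PC[].
have leS : darts S U <= 3 * #|S|.
  by rewrite mulnC -sum_nat_const leq_sum // => x _; apply: leq_deg3.
have leX : darts X U <= 6.
  by rewrite -X6 -sum1_card leq_sum.
(* The chain 3|P| <= [\sum_(C in P) darts C (~: C)] <= [darts S U + darts X U] <= 3|S| + 6 <= 3|P|
   collapses; this and the next two facts read off the termwise equalities. *)
have P1 C : C \in P -> #|C| = 1.
  move=> CP; apply/eqP; have [_ <-] := PC C CP; apply/eqP.
  apply: (@sum_squeeze _ P (fun=> 3) (fun C => darts C (~: C))) => //.
    by move=> D /PC[].
  rewrite sum_nat_const; lia.
have degS x : x \in S -> deg x U = 3.
  apply: (@sum_squeeze G S (fun x => deg x U) (fun=> 3)) => [z _|].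
    exact: leq_deg3.
  rewrite sum_nat_const -/(darts S U); lia.
have degX1 x : x \in X -> deg x U = 1.
  apply: (@sum_squeeze G X (fun x => deg x U) (fun=> 1)) => //.
  rewrite sum_nat_const -/(darts X U); lia.
have SU x y : x \in S -> adj x y -> y \in U.
  by move=> xS; apply: deg3_neighbours; rewrite degS.
have XU x y : x \in X -> adj x y -> y \in U :|: X.
  move=> xX; apply: deg3_neighbours; rewrite deg_setU ?degX1 ?ltnS ?degX //.
  by rewrite disjoint_subset; apply/subsetP => z /UX[].
(* No edge joins the leftover vertices to the rest. If there were any, they would induce a cubic
   graph, hence contain a cycle, and an empty cut would separate it from the one in [X]. *)
pose R := ~: (X :|: S :|: U).
have degR x : x \in R -> deg x R = 3.
  move=> xR; apply/eqP; rewrite eqn_leq leq_deg3 /= -(deg_setT x).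
  apply: leq_deg => y _ xy; apply: contraTT xR.
  rewrite !inE !negbK => /orP[/orP[yX|yS]|yU].
  - have := XU y x yX; rewrite adj_sym => /(_ xy).
    by rewrite inE => /orP[] ->; rewrite ?orbT.
  - by rewrite (SU y x) ?orbT // adj_sym.
  have [//|] := boolP (x \in X); have [//|xS xX] := boolP (x \in S).
  have /bigcupP[C CP yC] := yU; have [_ _ clC] := PP C CP.
  by rewrite (PU C) // (clC y) ?inE ?xS // adj_sym.
have R0 : R = set0.
  apply/eqP/negPn/negP => R0.
  have dR : darts R R = 3 * #|R|.
    by rewrite /darts (eq_bigr _ degR) sum_nat_const mulnC.
  have cycR : contains_cycle R by apply: dense_cycle; lia.
  have cycR' : contains_cycle (~: R).
    by have [c cyc sc] := cycX; exists c => // x /sc xX; rewrite !inE xX.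
  by have := cyclic_cut G4 cycR cycR'; have := darts_cut R; lia.
(* Edges at [S] end in [U], and two adjacent vertices of [U] would lie in the same singleton of
   [P]. *)
exists [set x : del_vertices X | val x \in S] => x y xy; rewrite !inE.
have [xS|xS] := boolP (val x \in S).
  by have [_ /negPf->] := UX _ (SU _ _ xS xy).
have xU : val x \in U.
  by have := in_set0 (val x); rewrite -R0 !inE (negPf xS) (negPf (valP x));
    move=> /negbFE.
have [//|yS] := boolP (val y \in S).
have /bigcupP[C CP xC] := xU; have [_ _ clC] := PP C CP.
have /eqP/cards1P[z Cz] := P1 C CP.
have yC : val y \in C by apply: clC xC _ xy; rewrite !inE yS (valP y).
move: xC yC; rewrite Cz !inE => /eqP xz /eqP yz.
by move: xy; rewrite /= /del_vertices_adj /= xz yz adj_irrefl.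
Qed.

End Cubic.

Theorem theorem2p2 (G : sgraph)
  (Gcubic : cubic G)
  (Gcyc4 : cyclically_edge_connected 4 G)
  (Ghex : exists2 H0 : seq G, is_cycle H0 & size H0 = 6) :
  forall H : seq G, is_cycle H -> size H = 6 ->
    has_perfect_matching (del_vertices [set x in H])
    \/ bipartite (del_vertices [set x in H]).
Proof.
move=> H cycH H6; have [/andP[cH uH] _] := cycH.
apply: hexagon_complement => // [||x].
- by exists H => // x; rewrite inE.
- by rewrite cardsE (card_uniqP uH).
rewrite inE => xH; rewrite deg_card.
(* With the hexagon rotated to start at [x], its second and last vertices are two distinct
   neighbours of [x]. *)
have [i s rotH] := rot_to xH.
move: cH uH H6; rewrite -(rot_cycle i) -(rot_uniq i) -(size_rot i) rotH.
case/lastP: s rotH => [//|[//|y s] z] rotH /= /andP[xy].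
rewrite rcons_path last_rcons => /andP[_ zx].
rewrite mem_rcons inE negb_or => /andP[_ /andP[/andP[yNz _] _]] _.
have <- : #|[set y; z]| = 2 by rewrite cards2 yNz.
apply/subset_leq_card/subsetP => w; rewrite !inE -(mem_rot i) rotH.
rewrite !inE mem_rcons inE.
by case/orP=> /eqP->; rewrite eqxx ?orbT //= adj_sym.
Qed.
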